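(* Let $m,n_1,n_2\in\mathbb N$ with $m\ge 4$ even. Then the graph $C_{m,(n_1,n_2)}$ admits a uniformly ordered labeling.
   Context: $\mathbb N=\{0,1,2,\dots\}$; for integers $a\le b$, $[a,b]=\{x\in\mathbb N: a\le x\le b\}$. For $m\ge3$ and $n_1,n_2\ge 0$, $C_{m,(n_1,n_2)}$ is the connected graph with $m+n_1+n_2$ vertices and $m+n_1+n_2$ edges consisting of a cycle $C_m$ and two paths $P_{n_1+1}$, $P_{n_2+1}$ ($P_{k}$ has $k$ vertices), where the cycle and the two paths all share exactly one common vertex (the root), which is an end vertex of each path, and no other vertices are shared. For a graph $G=(V,E)$ with $|E|=m'$ and $t\in\mathbb N$, a labeling is an injective map $f\colon V\to[0,t]$; it induces $\tilde f(\{u,v\})=|f(u)-f(v)|$. $f$ is a $\overline{\rho}$-labeling if (a) $t\ge 2m'$, (b) $\tilde f$ is injective, (c) there is no $i\in\{1,\dots,m'\}$ with both $i$ and $t+1-i$ in $\operatorname{Im}\tilde f$. If $G$ is bipartite with vertex bipartition $\{A,B\}$, an $(A,B,t)$-uniformly ordered labeling is a $\overline{\rho}$-labeling $f\colon V\to[0,t]$ for which there is $\lambda\in\mathbb N$ with $f(a)\le\lambda$ for all $a\in A$ and $f(b)>\lambda$ for all $b\in B$. A uniformly ordered labeling of a bipartite graph $G$ with $m'$ edges is a labeling $f\colon V\to[0,2m']$ that is $(A,B,2m')$-uniformly ordered for some vertex bipartition $\{A,B\}$ of $G$. *)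

(* Defs.v *)
From mathcomp Require Import all_boot all_order all_algebra zify.

Set Implicit Arguments.
Unset Strict Implicit.
Unset Printing Implicit Defensive.

(* A finite simple graph is a symmetric irreflexive [e : rel T], [T : finType]. *)
Section Labelings.
Variables (T : finType) (e : rel T).

Definition edges : {set {set T}} :=
  [set [set p.1; p.2] | p : T * T & e p.1 p.2].

Definition bipartition (A B : {set T}) : Prop :=
  [/\ A :&: B = set0, A :|: B = [set: T] &
      forall x y, e x y ->
        (x \in A) && (y \in B) || (x \in B) && (y \in A)].

Definition labeling (t : nat) (f : T -> nat) : Prop :=
  injective f /\ forall v, f v <= t.

(* The subtraction is that of [int]. The value is symmetric in [x] and [y], so
   it depends only on the edge [set x; y]. *)
Definition induced (f : T -> nat) (x y : T) : nat := `|f x - f y|%N.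

Definition induced_injective (f : T -> nat) : Prop :=
  forall x y u v, e x y -> e u v ->
    induced f x y = induced f u v -> [set x; y] = [set u; v].

Definition induced_image (f : T -> nat) (i : nat) : Prop :=
  exists x y, e x y /\ induced f x y = i.

Definition rhobar_labeling (t : nat) (f : T -> nat) : Prop :=
  [/\ labeling t f, 2 * #|edges| <= t, induced_injective f &
      forall i, 1 <= i <= #|edges| ->
        ~ (induced_image f i /\ induced_image f (t + 1 - i))].

Definition ABt_uniformly_ordered
    (A B : {set T}) (t : nat) (f : T -> nat) : Prop :=
  rhobar_labeling t f /\
  exists lambda : nat,
    (forall a, a \in A -> f a <= lambda) /\
    (forall b, b \in B -> lambda < f b).

Definition uniformly_ordered_labeling (f : T -> nat) : Prop :=
  exists A B : {set T},
    bipartition A B /\ ABt_uniformly_ordered A B (2 * #|edges|) f.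

End Labelings.

Definition cycle_arc (m i j : nat) : bool := (i < m) && (j == i.+1 %% m).

(* The path 0, k, k + 1, ..., k + n - 1, oriented away from 0. *)
Definition path_arc (k n i j : nat) : bool :=
  (k <= j < k + n) && (i == if j == k then 0 else j.-1).

Definition cycle_two_paths_arc (m n1 n2 i j : nat) : bool :=
  [|| cycle_arc m i j, path_arc m n1 i j | path_arc (m + n1) n2 i j].

(* C_{m,(n1,n2)} for m >= 3: the root is 0, the cycle is 0, ..., m - 1, and the
   paths continue from 0 through the next n1, resp. the last n2, vertices. *)
Definition cycle_two_paths (m n1 n2 : nat) : rel 'I_(m + n1 + n2) :=
  fun i j => cycle_two_paths_arc m n1 n2 i j || cycle_two_paths_arc m n1 n2 j i.

Section CycleTwoPathsFacts.
Variables m n1 n2 : nat.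
Hypothesis m_ge3 : 2 < m.

Definition pred_vertex (j : nat) : nat :=
  if j == 0 then m.-1 else if (j == m) || (j == m + n1) then 0 else j.-1.

Lemma cycle_arcE i j :
  cycle_arc m i j = (j < m) && (i == if j == 0 then m.-1 else j.-1).
Proof.
rewrite /cycle_arc; have [lt_im|le_mi] := ltnP i m => /=.
  have [lt_iSm|le_mSi] := ltnP i.+1 m; first by rewrite modn_small //; case: (j =P 0); lia.
  by have -> : i.+1 = m; [lia|rewrite modnn; case: (j =P 0); lia].
by case: (j =P 0); lia.
Qed.

Lemma cycle_two_paths_arcE i j : j < m + n1 + n2 ->
  cycle_two_paths_arc m n1 n2 i j = (i == pred_vertex j).
Proof.
rewrite /cycle_two_paths_arc cycle_arcE /path_arc /pred_vertex.
by case: (j =P 0) => ?; case: (j =P m) => ?; case: (j =P m + n1) => ? /=; lia.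
Qed.

Lemma pred_vertex_lt j : j < m + n1 + n2 -> pred_vertex j < m + n1 + n2.
Proof. by rewrite /pred_vertex; case: ifP => _; [|case: ifP => _]; lia. Qed.

Definition pred_ord (j : 'I_(m + n1 + n2)) : 'I_(m + n1 + n2) :=
  Ordinal (pred_vertex_lt (ltn_ord j)).

Lemma cycle_two_pathsE i j :
  cycle_two_paths i j = (i == pred_ord j) || (j == pred_ord i).
Proof. by rewrite /cycle_two_paths /= !cycle_two_paths_arcE. Qed.

Lemma cycle_two_paths_sym : symmetric (@cycle_two_paths m n1 n2).
Proof. by move=> i j; rewrite /cycle_two_paths /= orbC. Qed.

Lemma cycle_two_paths_irr : irreflexive (@cycle_two_paths m n1 n2).
Proof.
move=> i; rewrite cycle_two_pathsE orbb -val_eqE /= /pred_vertex.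
by have := ltn_ord i; case: ifP => ?; [|case: ifP => ?]; lia.
Qed.

Lemma card_edges_cycle_two_paths :
  #|edges (@cycle_two_paths m n1 n2)| = m + n1 + n2.
Proof.
have -> : edges (@cycle_two_paths m n1 n2) =
          [set [set pred_ord j; j] | j : 'I_(m + n1 + n2)].
  apply/setP=> s; apply/imsetP/imsetP=> [[[x y]]|[j _ ->]].
    rewrite inE /= cycle_two_pathsE => /orP[/eqP->|/eqP->] ->; first by exists y.
    by exists x; rewrite // setUC.
  by exists (pred_ord j, j); rewrite ?inE //= cycle_two_pathsE eqxx.
rewrite card_imset ?card_ord // => j k Ejk.
have: j \in [set pred_ord k; k] by rewrite -Ejk !inE eqxx orbT.
have: k \in [set pred_ord j; j] by rewrite Ejk !inE eqxx orbT.
rewrite !inE -!val_eqE /= => kj jk; apply: val_inj => /=.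
move: kj jk; rewrite /pred_vertex; have := ltn_ord j; have := ltn_ord k.
by do 4!(try case: ifP => ?); lia.
Qed.

Lemma cycle_two_paths_connected i j : connect (@cycle_two_paths m n1 n2) i j.
Proof.
suff to0 k : val k = 0 -> forall x, connect (@cycle_two_paths m n1 n2) x k.
  have lt0 : 0 < m + n1 + n2 by lia.
  apply: (connect_trans (to0 (Ordinal lt0) erefl i)).
  by rewrite (sym_connect_sym cycle_two_paths_sym) to0.
move=> k0 x; have [n le_xn] := ubnP (val x).
elim: n x le_xn => // n IHn x le_xn.
have [x0|x_neq0] := eqVneq (val x) 0.
  by have -> : x = k; [apply: val_inj; rewrite x0|exact: connect0].
apply: (@connect_trans _ _ (pred_ord x)).
  by apply: connect1; rewrite cycle_two_pathsE eqxx orbT.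
apply: IHn; rewrite /= /pred_vertex (negPf x_neq0).
by case: ifP => _; move: x_neq0 le_xn => /=; lia.
Qed.

End CycleTwoPathsFacts.

(* Main.v *)
Require Import Defs.
From mathcomp Require Import all_boot all_order all_algebra.
From mathcomp Require Import zify.

(* Write m = 2r + 2 and w = m + n1 + n2, the number of edges. A labeling works
   as soon as it separates the two sides and no two edges have differences that
   are equal or sum to 2w + 1. The two paths are labeled as one long zigzag
   through the root, low labels moving one way and high labels the other, so
   that its n1 + n2 differences are consecutive; the cycle minus the root is a
   monotone zigzag as well.
   - If n2 is small, the paths take the differences 1, ..., n1 + n2 and occupy an
     interval of labels. The cycle lies around it: its low vertices other than
     the root are below, its high ones above. Its zigzag has one jump.
   - If n2 >= r, the cycle without the root is an interval of labels, lying
     between the low and the high labels of the paths, with differences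
     1, ..., 2r. The root edges of the cycle have differences w - r and w. The
     paths use the differences w + 2, ..., 2w - 2r except w + r + 1, which is
     complementary to w - r; the second path jumps over it. *)

(** Each edge joins a unique [i] to [pred_vertex m n1 i], so [g] lists the differences by vertex. *)
Lemma uniformly_ordered_cycle_two_paths (m n1 n2 : nat) (f g : nat -> nat)
    (lambda : nat) :
    2 < m ->
    (forall i, i < m + n1 + n2 -> f i <= 2 * (m + n1 + n2)) ->
    (forall i j, i < m + n1 + n2 -> j < m + n1 + n2 -> f i = f j -> i = j) ->
    (forall i, i < m + n1 + n2 ->
       f (pred_vertex m n1 i) <= lambda < f i /\
         f i = f (pred_vertex m n1 i) + g i \/
       f i <= lambda < f (pred_vertex m n1 i) /\
         f (pred_vertex m n1 i) = f i + g i) ->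
    (forall i j, i < m + n1 + n2 -> j < m + n1 + n2 ->
       g i = g j \/ g i + g j = (2 * (m + n1 + n2)).+1 -> i = j) ->
  uniformly_ordered_labeling (@cycle_two_paths m n1 n2) (fun v => f v).
Proof.
move=> m_gt2 f_le f_inj f_diff g_inj.
have indE (x y : 'I_(m + n1 + n2)) : cycle_two_paths x y ->
    exists k : 'I_(m + n1 + n2),
      [set x; y] = [set pred_ord m_gt2 k; k] /\
      induced (fun v : 'I_(m + n1 + n2) => f v) x y = g k.
  rewrite (cycle_two_pathsE m_gt2) => /orP[/eqP xE|/eqP yE].
    exists y; rewrite -xE; split=> //.
    by rewrite /induced; have := f_diff y (ltn_ord y); rewrite xE /=; lia.
  exists x; rewrite -yE setUC; split=> //.
  by rewrite /induced; have := f_diff x (ltn_ord x); rewrite yE /=; lia.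
exists [set v : 'I_(m + n1 + n2) | f v <= lambda],
  [set v : 'I_(m + n1 + n2) | lambda < f v]; split.
  split.
  - by apply/setP=> v; rewrite !inE; lia.
  - by apply/setP=> v; rewrite !inE; lia.
  move=> x y; rewrite (cycle_two_pathsE m_gt2) !inE => /orP[] /eqP->.
    by have := f_diff y (ltn_ord y); rewrite /=; lia.
  by have := f_diff x (ltn_ord x); rewrite /=; lia.
rewrite /ABt_uniformly_ordered /rhobar_labeling card_edges_cycle_two_paths //.
split; last by exists lambda; split=> v; rewrite inE.
split=> //.
- split=> [x y /f_inj xy|v]; last exact/f_le.
  by apply/val_inj/xy.
- move=> x y u v /indE[k [-> ->]] /indE[l [-> ->]] gkl.
  have kl : k = l :> nat by apply: g_inj; [| |left].
  by have -> : k = l by apply: val_inj.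
move=> i i_range [[x [y [/indE[k [_ ->]] gk]]] [u [v [/indE[l [_ ->]] gl]]]].
have kl : k = l :> nat by apply: g_inj => //; right; lia.
by move: gl; rewrite -kl gk; lia.
Qed.

(** Successive differences: [d], [d - 1], ... *)
Definition inward_zigzag (a d i : nat) : nat :=
  if odd i then a + d - i./2 else a + i./2.

Definition outward_zigzag (a d i : nat) : nat :=
  if odd i then a + d + i./2 else a - i./2.

(* [r - v./2] and [s + r - 2 + ...] are the low and high labels of the cycle. The
   high ones jump by [J] instead of 1 after the first [u] edges of the zigzag,
   whose first difference is [n1 + n2 + s]. *)
Definition tight_label (s u J r n1 n2 v : nat) : nat :=
  if v == 0 then s + r - 2
  else if v < 2 * r + 2 then
    if odd v then s + r - 2 + n1 + n2 + v.+1./2 + (if u < v then J - 1 else 0)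
    else r - v./2
  else if v < 2 * r + 2 + n1 then inward_zigzag (s + r - 2) n1 (v - (2 * r + 1))
  else outward_zigzag (s + r - 2) (n1 + 1) (v - (2 * r + 1 + n1)).

(* The edge from [pred_vertex v] to [v] has difference [tight_diff v]. *)
Definition tight_diff (s u J r n1 n2 v : nat) : nat :=
  if v == 0 then n1 + n2 + r + J
  else if v == 1 then n1 + n2 + 1
  else if v < 2 * r + 2 then
    n1 + n2 + s + v - 2 + (if u.+1 < v then J - 1 else 0)
  else if v < 2 * r + 2 + n1 then 2 * r + 2 + n1 - v
  else v - (2 * r + 1).

(** The jump skips the complement of the root difference [n1 + n2 + r + J] and, for even [r], also
    that difference and the complements of the first [u] zigzag differences. *)
Lemma tight_labeling (s u J r n1 n2 : nat) :
    (odd r /\ [/\ s = 2 * r + 3, u = r & J = 2]) \/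
    (~~ odd r /\ [/\ s = r + 3, u = r - 1 & J = r + 2]) ->
    0 < r -> n2 <= 2 * r + 3 ->
  uniformly_ordered_labeling (@cycle_two_paths (2 * r + 2) n1 n2)
    (fun v => tight_label s u J r n1 n2 v).
Proof.
move=> suJ r_gt0 n2_le.
(* These bounds settle the labels for both parities at once. *)
have [/andP[u_odd u_le] n2_lt s_ge J_gt0 s_le] :
    [/\ odd u && (u <= r), n2 + 3 <= 2 * s, r + 3 <= s, 0 < J & s + J <= 2 * r + 5].
  by case: suJ => -[? [-> -> ->]]; split; lia.
apply: (@uniformly_ordered_cycle_two_paths _ _ _ _ (tight_diff s u J r n1 n2)
  (s + r - 2 + n1./2)).
- by lia.
- move=> {suJ} i i_lt; rewrite /tight_label /inward_zigzag /outward_zigzag ?eqxx;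
    repeat (case: ifP => ?); lia.
- move=> {suJ} i j i_lt j_lt; rewrite /tight_label /inward_zigzag /outward_zigzag ?eqxx;
    repeat (case: ifP => ?); lia.
- move=> {suJ} i i_lt; rewrite /pred_vertex; repeat (case: ifP => ?);
    rewrite /tight_label /tight_diff /inward_zigzag /outward_zigzag ?eqxx;
    repeat (case: ifP => ?; try by (exfalso; lia));
    first [by left; split; lia | by right; split; lia].
- move=> i j i_lt j_lt; rewrite /tight_diff;
    case: suJ => -[r_par [sE uE JE]]; subst s u J; repeat (case: ifP => ?); lia.
Qed.

(* The second path skips a difference after [n2 + 1 - r] edges. From there on,
   only the vertices on the side opposite to that of vertex [n2 + 1 - r] of the
   path are shifted, which depends on its parity. *)
Definition wide_label (r n1 n2 v : nat) : nat :=
  let w := 2 * r + 2 + n1 + n2 in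
  if v == 0 then n1./2
  else if v < 2 * r + 2 then
    if odd v then n1./2 + w - r + v./2 else n1./2 + w - r - v./2
  else if v < 2 * r + 2 + n1 then
    outward_zigzag n1./2 (w + n2 + 3) (v - (2 * r + 1))
  else
    let i := v - (2 * r + 1 + n1) in
    if i <= n2 + 1 - r then inward_zigzag n1./2 (w + n2 + 2) i
    else if odd (n2 + 1 - r) then inward_zigzag n1./2.+1 (w + n2 + 1) i
    else inward_zigzag n1./2 (w + n2 + 1) i.

(** Without the skip, edge [n2 + 2 - r] of the second path would get [w + r + 1]. *)
Definition wide_diff (r n1 n2 v : nat) : nat :=
  let w := 2 * r + 2 + n1 + n2 in
  if v == 0 then w
  else if v == 1 then w - r
  else if v < 2 * r + 2 then v - 1
  else if v < 2 * r + 2 + n1 then w + n2 + 2 + (v - (2 * r + 1))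
  else w + n2 + 3 - (v - (2 * r + 1 + n1))
       - (if n2 + 1 - r < v - (2 * r + 1 + n1) then 1 else 0).

Lemma wide_labeling (r n1 n2 : nat) :
    0 < r -> r <= n2 ->
  uniformly_ordered_labeling (@cycle_two_paths (2 * r + 2) n1 n2)
    (fun v => wide_label r n1 n2 v).
Proof.
move=> r_gt0 r_le.
apply: (@uniformly_ordered_cycle_two_paths _ _ _ _ (wide_diff r n1 n2)
  (n1./2 + (2 * r + 2 + n1 + n2) - r - 1)).
- by lia.
- move=> i i_lt; rewrite /wide_label /inward_zigzag /outward_zigzag ?eqxx;
    repeat (case: ifP => ?); lia.
- move=> i j i_lt j_lt; rewrite /wide_label /inward_zigzag /outward_zigzag ?eqxx;
    repeat (case: ifP => ?); lia.
- move=> i i_lt; rewrite /pred_vertex; repeat (case: ifP => ?);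
    rewrite /wide_label /wide_diff /inward_zigzag /outward_zigzag ?eqxx;
    repeat (case: ifP => ?; try by (exfalso; lia));
    first [by left; split; lia | by right; split; lia].
- move=> i j i_lt j_lt; rewrite /wide_diff;
    repeat (case: ifP => ?); lia.
Qed.

Theorem theorem4 (m n1 n2 : nat) (hm : 4 <= m) (hev : ~~ odd m) :
  exists f : 'I_(m + n1 + n2) -> nat,
    uniformly_ordered_labeling (@cycle_two_paths m n1 n2) f.
Proof.
have [r mE r_gt0] : exists2 r, m = 2 * r + 2 & 0 < r by exists (m./2 - 1); lia.
clear hm hev; subst m; have [n2_le|n2_gt] := leqP n2 (2 * r + 3).
  have [r_odd|r_even] := boolP (odd r).
    by eexists; apply: (tight_labeling (2 * r + 3) r 2) => //; left.
  by eexists; apply: (tight_labeling (r + 3) (r - 1) (r + 2)) => //; right.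
by eexists; apply: wide_labeling => //; lia.
Qed.
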